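(* Let $(X,d,\mu,\mathcal{E},\mathcal{F})$ be a Dirichlet space satisfying the standing assumptions (A1)–(A3), (HK), (BE) stated in the context, and let $0<\delta<1$. Assume $d_H>\delta d_W$. There exists a constant $C>0$ such that for every measurable $E\subset X$ with finite measure, $$\mu(E)^{\frac{d_H-\delta d_W}{d_H}}\le C\int_E\int_{X\setminus E}\frac{1}{d(x,y)^{d_H+\delta d_W}}\,d\mu(y)\,d\mu(x).$$
   Context: Setting. $(X,d,\mu)$ is a locally compact metric measure space, $\mu$ a Radon measure supported on $X$, and $(\mathcal{E},\mathcal{F})$ is a Dirichlet form on $L^2(X,\mu)$ with heat semigroup $\{P_t\}_{t>0}$. Write $B(x,r)=\{y: d(x,y)<r\}$. For $\lambda>0$, $1\le p<\infty$, $KS^{\lambda,p}(X)$ is the set of $f\in L^p(X,\mu)$ with $\limsup_{r\to0^+}\int_X\int_{B(x,r)}\frac{|f(x)-f(y)|^p}{r^{\lambda p}\mu(B(x,r))}d\mu(y)d\mu(x)<\infty$. Standing assumptions. (A1) Every ball $B(x,r)$ has compact closure. (A2) There are $c_1,c_2,d_H>0$ with $c_1r^{d_H}\le\mu(B(x,r))\le c_2r^{d_H}$ for all $x\in X$, $r\ge0$. (A3) $(\mathcal{E},\mathcal{F})$ is regular and strongly local. (HK) $\{P_t\}$ has a continuous heat kernel $p_t(x,y)$ and there are $c_3,c_4,c_5,c_6\in(0,\infty)$, $d_W\in[2,\infty)$ with $c_5t^{-d_H/d_W}\exp(-c_6(d(x,y)^{d_W}/t)^{1/(d_W-1)})\le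 p_t(x,y)\le c_3t^{-d_H/d_W}\exp(-c_4(d(x,y)^{d_W}/t)^{1/(d_W-1)})$ for $\mu\times\mu$-a.e. $(x,y)$ and every $t>0$. (BE) There is $C>0$ such that $|P_tg(x)-P_tg(y)|\le C\frac{d(x,y)^\kappa}{t^{\kappa/d_W}}\|g\|_{L^\infty(X,\mu)}$ for all $t>0$, $g\in L^\infty(X,\mu)$, $x,y\in X$, where $0<\kappa<d_W$ is defined by $d_W-\kappa=\sup\{\lambda>0: KS^{\lambda,1}(X)\text{ contains non-constant functions}\}$. *)

(* Defs.v *)
From HB Require Import structures.
From mathcomp Require Import all_boot all_order all_algebra.
From mathcomp Require Import all_classical all_reals all_analysis.

Set Implicit Arguments.
Unset Strict Implicit.
Unset Printing Implicit Defensive.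

Import Order.TTheory GRing.Theory Num.Theory.
Import numFieldNormedType.Exports.

Local Open Scope classical_set_scope.
Local Open Scope ring_scope.

(* [measurableType] inherits from [pointedType], so the metric spaces that carry
   a Borel sigma-algebra have to be pointed, i.e., nonempty. *)
#[short(type="pmetricType")]
HB.structure Definition PointedMetric (K : numDomainType) :=
  {M of Metric K M & PseudoPointedMetric K M}.

Notation borelType X := (g_sigma_algebraType (@open X)).

Section L2.
Context {R : realType} {d : measure_display} {T : measurableType d}.
Variable mu : {measure set T -> \bar R}.
Implicit Types f g h : T -> R.

Definition L2norm f : \bar R := 'N[mu]_2%:E[EFin \o f].

Definition L2inner f g : R := \int[mu]_x (f x * g x).

Definition cvg_L2_at0 (u : R -> T -> R) h : Prop :=
  L2norm (u t \- h) @[t --> 0^'+] --> 0%E.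

End L2.

(* Elements of L^p spaces are represented by functions, [dom] and [form] being
   invariant under almost everywhere equality. *)
Section dirichlet.
Context {R : realType} {d : measure_display} {T : measurableType d}.
Variable mu : {measure set T -> \bar R}.
Variables (dom : set (T -> R)) (form : (T -> R) -> (T -> R) -> R).
Implicit Types f g h : T -> R.

Definition form1 f g : R := form f g + L2inner mu f g.

Definition unit_contraction f : T -> R := fun x => Num.min (Num.max (f x) 0) 1.

Record is_dirichlet_form : Prop := {
  dirichlet_sub_L2 : forall f, dom f -> f \in Lfun mu 2%:E ;
  dirichlet_dom_ae : forall f g, dom f -> measurable_fun setT g ->
    f = g %[ae mu] -> dom g ;
  dirichlet_form_ae : forall f g h, dom f -> dom g -> dom h ->
    f = g %[ae mu] -> form f h = form g h ;
  dirichlet_dom_linear : forall a f g, dom f -> dom g -> dom (a \*: f \+ g) ;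
  dirichlet_form_linear : forall a f g h, dom f -> dom g -> dom h ->
    form (a \*: f \+ g) h = a * form f h + form g h ;
  dirichlet_form_sym : forall f g, dom f -> dom g -> form f g = form g f ;
  dirichlet_form_ge0 : forall f, dom f -> 0 <= form f f ;
  dirichlet_dense : forall f (e : R), f \in Lfun mu 2%:E -> 0 < e ->
    exists2 g, dom g & (L2norm mu (f \- g)%R < e%:E)%E ;
  dirichlet_closed : forall u : nat -> T -> R, (forall n, dom (u n)) ->
    (forall e : R, 0 < e -> exists N : nat, forall m n : nat,
      (N <= m)%N -> (N <= n)%N -> form1 (u m \- u n) (u m \- u n) < e) ->
    exists2 v, dom v & form1 (u n \- v) (u n \- v) @[n --> \oo] --> (0 : R) ;
  dirichlet_markov : forall f, dom f ->
    dom (unit_contraction f) /\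
    form (unit_contraction f) (unit_contraction f) <= form f f }.

(* The strongly continuous symmetric contraction semigroup on L^2 whose
   infinitesimal generator is the self-adjoint operator L of the form:
   L u = h iff u is in [dom] and form u v = - <h, v> for all v in [dom].
   Compatibility of [P t] with almost everywhere equality follows from
   linearity and contractivity. *)
Record is_heat_semigroup (P : R -> (T -> R) -> (T -> R)) : Prop := {
  heat_L2 : forall t f, 0 < t -> f \in Lfun mu 2%:E ->
    P t f \in Lfun mu 2%:E ;
  heat_linear : forall t a f g, 0 < t ->
    f \in Lfun mu 2%:E -> g \in Lfun mu 2%:E ->
    P t (a \*: f \+ g) = a \*: P t f \+ P t g %[ae mu] ;
  heat_contraction : forall t f, 0 < t -> f \in Lfun mu 2%:E ->
    (L2norm mu (P t f) <= L2norm mu f)%E ;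
  heat_sym : forall t f g, 0 < t ->
    f \in Lfun mu 2%:E -> g \in Lfun mu 2%:E ->
    L2inner mu (P t f) g = L2inner mu f (P t g) ;
  heat_semigroup : forall s t f, 0 < s -> 0 < t -> f \in Lfun mu 2%:E ->
    P (s + t) f = P s (P t f) %[ae mu] ;
  heat_continuous : forall f, f \in Lfun mu 2%:E ->
    cvg_L2_at0 mu (fun t => P t f) f ;
  heat_generator : forall u h,
    u \in Lfun mu 2%:E -> h \in Lfun mu 2%:E ->
    (cvg_L2_at0 mu (fun t => t^-1 \*: (P t u \- u)) h <->
     dom u /\ forall v, dom v -> form u v = - L2inner mu h v) }.

Definition kernel_op (p : R -> T -> T -> R) (t : R) (g : T -> R) : T -> R :=
  fun x => \int[mu]_y (p t x y * g y).

Definition is_heat_kernel (P : R -> (T -> R) -> (T -> R))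
    (p : R -> T -> T -> R) : Prop :=
  forall t f, 0 < t -> f \in Lfun mu 2%:E -> P t f = kernel_op p t f %[ae mu].

End dirichlet.

Section metric_measure.
Context {R : realType} {X : pmetricType R}.
Variable mu : {measure set (borelType X) -> \bar R}.
Implicit Types f g : X -> R.

Definition radon_measure : Prop :=
  [/\ forall K : set X, compact K -> (mu K < +oo)%E,
      forall A : set X, measurable (A : set (borelType X)) ->
        mu A = ereal_inf [set mu U | U in [set U : set X | open U /\ A `<=` U]]
    & forall U : set X, open U ->
        mu U = ereal_sup
          [set mu K | K in [set K : set X | compact K /\ K `<=` U]] ].

Definition full_support : Prop :=
  forall U : set X, open U -> U !=set0 -> (0 < mu U)%E.

Definition balls_precompact : Prop :=
  forall (x : X) (r : R), compact (closure (ball x r)).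

Definition ahlfors_regular (dH : R) : Prop :=
  exists c1 c2 : R, [/\ 0 < c1, 0 < c2 & forall (x : X) (r : R), 0 <= r ->
    ((c1 * r `^ dH)%:E <= mu (ball x r))%E /\
    (mu (ball x r) <= (c2 * r `^ dH)%:E)%E].

(* C_c(X) *)
Definition compactly_supported_continuous : set (X -> R) :=
  [set f | continuous f /\ compact (closure [set x | f x != 0])].

(* The support of the measure f.mu, which only depends on the class of f modulo
   almost everywhere equality. *)
Definition ae_support f : set X :=
  [set x | forall U : set X, open U -> U x ->
    ~ {ae mu, forall y, U y -> f y = 0}].

Definition KS (lam p : R) : set (X -> R) :=
  [set f | f \in Lfun mu p%:E /\
    (limf_esup (fun r : R =>
       \int[mu]_x \int[mu]_(y in ball x r)
         (`|f x - f y| `^ p / (r `^ (lam * p) * fine (mu (ball x r))))%:E)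
     0^'+ < +oo)%E].

Definition ae_constant f : Prop := exists c : R, {ae mu, forall x, f x = c}.

Definition critical_exponent1 : \bar R :=
  ereal_sup [set lam%:E | lam in
    [set lam : R | 0 < lam /\ exists2 f, KS lam 1 f & ~ ae_constant f]].

Section form.
Variables (dom : set (X -> R)) (form : (X -> R) -> (X -> R) -> R).

Definition regular_form : Prop :=
  exists core : set (X -> R),
    [/\ core `<=` dom `&` compactly_supported_continuous,
        forall f (e : R), dom f -> 0 < e ->
          exists2 g, core g & form1 mu form (f \- g) (f \- g) < e
      & forall f (e : R), compactly_supported_continuous f -> 0 < e ->
          exists2 g, core g & forall x, `|f x - g x| < e ].

Definition strongly_local_form : Prop :=
  forall f g, dom f -> dom g ->
    compact (ae_support f) -> compact (ae_support g) ->
    (exists (U : set X) (c : R),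
       [/\ open U, ae_support g `<=` U & {ae mu, forall y, U y -> f y = c}]) ->
    form f g = 0.

End form.

Section kernel.
Variable p : R -> X -> X -> R.

Definition continuous_kernel : Prop :=
  forall t, 0 < t -> continuous (fun z : X * X => p t z.1 z.2).

Definition sub_gaussian (dH dW c c' t : R) (x y : X) : R :=
  c * t `^ (- (dH / dW)) *
  expR (- (c' * (mdist x y `^ dW / t) `^ (1 / (dW - 1)))).

Definition sub_gaussian_bounds (dH dW : R) : Prop :=
  exists c3 c4 c5 c6 : R,
    [/\ [/\ 0 < c3, 0 < c4, 0 < c5 & 0 < c6] &
      forall t, 0 < t ->
        {ae (mu \x mu)%E, forall z : borelType X * borelType X,
           sub_gaussian dH dW c5 c6 t z.1 z.2 <= p t z.1 z.2 /\
           p t z.1 z.2 <= sub_gaussian dH dW c3 c4 t z.1 z.2}].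

(* For bounded g, P_t g is the everywhere defined function
   [kernel_op mu p t g]. *)
Definition weak_bakry_emery (dW kappa : R) : Prop :=
  exists C : R, 0 < C /\
    forall (t : R) g (x y : X), 0 < t -> g \in Lfun mu +oo%E ->
      `|kernel_op mu p t g x - kernel_op mu p t g y| <=
        C * (mdist x y `^ kappa / t `^ (kappa / dW)) *
        fine ('N[mu]_+oo[EFin \o g])%E.

End kernel.
End metric_measure.

(* Main.v *)
Require Import Defs.
From HB Require Import structures.
From mathcomp Require Import all_boot all_order all_algebra.
From mathcomp Require Import all_classical all_reals all_analysis.
From mathcomp Require Import ring.

(** The inequality is a consequence of volume growth.  Put [m := mu E] and
    [sigma := delta * dW], suppose [0 < m], and let [c1 * r `^ dH] be the lower
    bound on the measure of a ball of radius [r].  Choose the radius [r] with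
    [c1 * r `^ dH = 2 * m].  Every ball of radius [r] then has measure at least
    [2 * m], hence at least the mass [m] of it lies outside [E]
    ([measure_setD_ge]).  For [x] in [E] the kernel [d(x, y)^-(dH + sigma)] is at
    least [r^-(dH + sigma)] on [ball x r `\` E], so that the inner integral is at
    least [m / r^(dH + sigma)], uniformly in [x] ([ge_inner_integral]).
    Integrating over [E] bounds the double integral below by
    [m^2 / r^(dH + sigma)], which is a constant times [m^((dH - sigma) / dH)]
    because [r] is proportional to [m^(1 / dH)].

    Both integrals are bounded below by a constant on a measurable set
    ([ge0_integral_ge_cst]) directly from their definition as a supremum over
    simple functions.  This avoids proving that the inner integral is a measurable
    function of [x], which would go through the measurability of the distance
    for the product sigma-algebra. *)

Set Implicit Arguments.
Unset Strict Implicit.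
Unset Printing Implicit Defensive.

Import Order.TTheory GRing.Theory Num.Theory.
Import numFieldNormedType.Exports.
Import HBNNSimple.

Local Open Scope classical_set_scope.
Local Open Scope ring_scope.

(** The simple function [c * \1_A] is one of the competitors in the supremum
    that defines the integral of [f] over [D]. *)
Lemma ge0_integral_ge_cst (R : realType) (d : measure_display)
    (T : measurableType d) (mu : {measure set T -> \bar R}) (D A : set T)
    (f : T -> \bar R) (c : R) :
  measurable A -> A `<=` D -> 0 <= c ->
  (forall x, D x -> (0 <= f x)%E) -> (forall x, A x -> (c%:E <= f x)%E) ->
  (c%:E * mu A <= \int[mu]_(x in D) f x)%E.
Proof.
move=> mA AD c0 f0 cf.
pose h := scale_nnsfun (indic_nnsfun R mA) c0.
have <- : sintegral mu h = (c%:E * mu A)%E.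
  rewrite -(sintegral_indic mu A).
  exact: (sintegralrM mu c (indic_nnsfun R mA)).
rewrite ge0_integralE//; apply: ereal_sup_ubound; exists h => // x.
have -> : h x = c * \1_A x by [].
rewrite indicE /patch; have [Ax|nAx] := boolP (x \in A).
  by rewrite mulr1 mem_set; [|exact/AD/set_mem]; exact/cf/set_mem.
by rewrite mulr0; case: ifPn => // /set_mem /f0.
Qed.

Lemma measure_setD_ge (R : realType) (d : measure_display)
    (T : measurableType d) (mu : {measure set T -> \bar R}) (A B : set T)
    (m : R) :
  measurable A -> measurable B -> (mu B <= m%:E)%E ->
  ((2 * m)%:E <= mu A)%E -> (m%:E <= mu (A `\` B))%E.
Proof.
move=> mA mB Bm Am.
have ABm : (mu (A `&` B) <= m%:E)%E.
  by apply: le_trans Bm; apply: le_measure; rewrite ?inE//; exact: measurableI.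
rewrite -(leeD2rE (x := m%:E))// -EFinD -mulr2n -mulr_natl.
by rewrite (le_trans Am)// (measureDI mu mA mB) leeD2l.
Qed.

Lemma open_mball (R : realType) (X : metricType R) (x : X) (r : R) :
  open (ball x r).
Proof.
rewrite openE => y; rewrite ballEmdist /= => xy.
apply/nbhs_ballP; exists (r - mdist x y) => /=; first by rewrite subr_gt0.
move=> z; rewrite !ballEmdist /= => yz.
rewrite (le_lt_trans (metric_triangle x y z))// addrC -ltrBrDr.
exact: yz.
Qed.

Lemma measurable_mball (R : realType) (X : pmetricType R) (x : X) (r : R) :
  measurable (ball x r : set (borelType X)).
Proof. by apply: sub_sigma_algebra; exact: open_mball. Qed.

(** On [ball x r `\` E] the distance to [x] is both positive, as [x] is in [E],
    and less than [r]. Positivity matters as [0^-1 = 0]. *)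
Lemma ge_inner_integral (R : realType) (X : pmetricType R)
    (mu : {measure set (borelType X) -> \bar R}) (E : set (borelType X))
    (m r s : R) (x : X) :
  measurable E -> E x -> 0 <= m -> (mu E <= m%:E)%E -> 0 <= r -> 0 <= s ->
  ((2 * m)%:E <= mu (ball x r))%E ->
  ((m / r `^ s)%:E <=
   \int[mu]_(y in ~` E) ((mdist x (y : X) `^ s)^-1)%:E)%E.
Proof.
move=> mE Ex m0 Em r0 s0 Bm.
have mB := measurable_mball x r.
rewrite mulrC EFinM.
apply: (@le_trans _ _ (((r `^ s)^-1)%:E * mu (ball x r `\` E))%E).
  rewrite lee_wpmul2l ?lee_fin ?invr_ge0 ?powR_ge0//.
  exact: measure_setD_ge.
apply: ge0_integral_ge_cst => [| | |y _|y [Bxy nEy]].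
- exact: measurableD.
- exact: subDsetr.
- by rewrite invr_ge0 powR_ge0.
- by rewrite lee_fin invr_ge0 powR_ge0.
- have xy : x != y by apply/eqP => xy; apply: nEy; rewrite -xy.
  have d0 : 0 < mdist x y by rewrite mdist_gt0.
  move: Bxy; rewrite ballEmdist /= => dr.
  have r_gt0 := lt_trans d0 dr.
  rewrite lee_fin lef_pV2 ?posrE ?powR_gt0//.
  by rewrite ge0_ler_powR ?nnegrE ?(ltW dr) ?(ltW d0).
Qed.

(** The fractional isoperimetric inequality of order [sigma] in a space with
    lower volume growth of exponent [dH]. *)
Lemma fractional_isoperimetric (R : realType) (X : pmetricType R)
    (mu : {measure set (borelType X) -> \bar R}) (c dH sigma : R) :
  0 < c -> 0 < dH -> 0 <= sigma -> sigma < dH ->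
  (forall (x : X) (r : R), 0 <= r -> ((c * r `^ dH)%:E <= mu (ball x r))%E) ->
  forall E : set (borelType X), measurable E -> (mu E < +oo)%E ->
  ((fine (mu E) `^ ((dH - sigma) / dH))%:E <=
   ((2 / c) `^ ((dH + sigma) / dH))%:E *
   \int[mu]_(x in E) \int[mu]_(y in ~` E)
     ((mdist (x : X) (y : X) `^ (dH + sigma))^-1)%:E)%E.
Proof.
move=> c0 dH0 sigma0 sigma_lt growth E mE Eoo.
have s0 : 0 <= dH + sigma by rewrite addr_ge0// ltW.
set s := dH + sigma in s0 *; set I := (\int[mu]_(x in E) _)%E.
have inner_ge0 x :
    (0 <= \int[mu]_(y in ~` E) ((mdist (x : X) (y : X) `^ s)^-1)%:E)%E.
  by apply: integral_ge0 => y _; rewrite lee_fin invr_ge0 powR_ge0.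
have Efin : mu E \is a fin_num by rewrite ge0_fin_numE.
have [m0|] := eqVneq (fine (mu E)) 0.
  rewrite m0 powR0; last by rewrite mulf_neq0 ?invr_eq0 ?subr_eq0 ?gt_eqF.
  by rewrite mule_ge0 ?lee_fin ?powR_ge0//; exact: integral_ge0.
set m := fine (mu E) => m_neq0.
have m0 : 0 < m by rewrite lt_def m_neq0 fine_ge0.
have EmE : mu E = m%:E by rewrite fineK.
pose r := (2 / c * m) `^ dH^-1.
have k0 : 0 < 2 / c by rewrite divr_gt0.
have km0 : 0 < 2 / c * m by rewrite mulr_gt0.
have r0 : 0 < r by exact: powR_gt0.
have rdH : c * r `^ dH = 2 * m.
  rewrite /r -powRrM mulVf ?gt_eqF// powRr1 ?ltW//.
  by field; rewrite gt_eqF.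
have rs : r `^ s = (2 / c) `^ (s / dH) * m `^ (s / dH).
  by rewrite /r -powRrM [dH^-1 * s]mulrC powRM ?ltW.
have lower_I : ((m / r `^ s * m)%:E <= I)%E.
  rewrite EFinM -EmE; apply: ge0_integral_ge_cst => // [|x Ex].
    by rewrite divr_ge0 ?powR_ge0// ltW.
  apply: ge_inner_integral; rewrite ?EmE ?(ltW m0) ?(ltW r0)//.
  by rewrite -rdH; apply: growth; exact: ltW.
apply: le_trans (lee_wpmul2l _ lower_I); last by rewrite lee_fin powR_ge0.
rewrite -EFinM lee_fin rs.
have -> : (dH - sigma) / dH = 2%:R - s / dH.
  by rewrite /s; field; rewrite gt_eqF.
rewrite powRB ?m_neq0 ?implybT// powR_mulrn ?(ltW m0)//.
rewrite le_eqVlt; apply/orP; left; apply/eqP.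
by field; rewrite !gt_eqF ?powR_gt0.
Qed.

Theorem corollary4p11 (R : realType) (X : pmetricType R)
    (mu : {measure set (borelType X) -> \bar R})
    (dom : set (X -> R)) (form : (X -> R) -> (X -> R) -> R)
    (P : R -> (X -> R) -> (X -> R)) (p : R -> X -> X -> R)
    (dH dW kappa delta : R)
    (X_locally_compact : locally_compact [set: X])
    (mu_radon : radon_measure mu)
    (mu_support : full_support mu)
    (form_dirichlet : is_dirichlet_form mu dom form)
    (P_heat : is_heat_semigroup mu dom form P)
    (A1 : @balls_precompact R X)
    (dH_gt0 : 0 < dH)
    (A2 : ahlfors_regular mu dH)
    (A3_regular : regular_form mu dom form)
    (A3_strongly_local : strongly_local_form mu dom form)
    (dW_ge2 : 2 <= dW)
    (p_heat_kernel : is_heat_kernel mu P p)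
    (p_continuous : continuous_kernel p)
    (HK : sub_gaussian_bounds mu p dH dW)
    (kappa_gt0 : 0 < kappa)
    (kappa_lt_dW : kappa < dW)
    (kappa_def : (dW - kappa)%:E = critical_exponent1 mu)
    (BE : weak_bakry_emery mu p dW kappa)
    (delta_gt0 : 0 < delta)
    (delta_lt1 : delta < 1)
    (dH_gt : delta * dW < dH) :
  exists C : R, 0 < C /\
    forall E : set (borelType X), measurable E -> (mu E < +oo)%E ->
      ((fine (mu E) `^ ((dH - delta * dW) / dH))%:E <=
       C%:E * \int[mu]_(x in E) \int[mu]_(y in ~` E)
                ((mdist (x : X) (y : X) `^ (dH + delta * dW))^-1)%:E)%E.
Proof.
have [c1 [c2 [c1_gt0 _ volume]]] := A2.
exists ((2 / c1) `^ ((dH + delta * dW) / dH)); split.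
  by rewrite powR_gt0// divr_gt0.
apply: fractional_isoperimetric => //.
  by rewrite mulr_ge0 ?ltW// (lt_le_trans _ dW_ge2).
by move=> z r r0; exact: (volume z r r0).1.
Qed.
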